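(* Let $r\geq 1$ be an integer and let \[ \eta = \begin{cases} 1 & \text{if $r$ is odd},\\ 0 & \text{if $r$ is even}.\end{cases} \] Let $h:\mathbb{Z}_{\geq 1}\to\mathbb{C}$ satisfy $|h(d)| \ll d^\alpha$ for some $\alpha\in\left[0,\frac{r+2-\eta}{2r-2+2\eta}\right)$, and define $f:\mathbb{Z}_{\geq 1}\to\mathbb{C}$ by \[ f(n) = \begin{cases} h(d) & \text{if $n=d^r$ for a positive integer $d$},\\ 0 & \text{otherwise}.\end{cases} \] Then, for $x\geq 2$, \[ \sum_{n\leq x} f\left(\left\lfloor \frac{x}{n}\right\rfloor\right) = C_f x + O\left(x^{\frac{2(1+\alpha)}{3r+\eta}}\right), \qquad\text{where}\qquad C_f = \sum_{n=1}^\infty \frac{f(n)}{n(n+1)}. \]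
   Context: $\lfloor t\rfloor$ denotes the integer part of $t$. The sum over $n$ runs over positive integers $n\le x$. The implied constants in $\ll$ and $O$ may depend on $r$ and on $h$ (in particular on $\alpha$ and the constant in $|h(d)|\ll d^\alpha$). *)

(* Defs.v *)
From Stdlib Require Import Reals ZArith Classical ClassicalEpsilon.
From Coquelicot Require Import Coquelicot.

Definition floorN (t : R) : nat := Z.to_nat (Int_part t).

Definition eta (r : nat) : R := if Nat.odd r then 1%R else 0%R.

Definition f_of (r : nat) (h : nat -> C) (n : nat) : C :=
  match excluded_middle_informative (exists d : nat, (1 <= d)%nat /\ Nat.pow d r = n) with
  | left H => h (proj1_sig (constructive_indefinite_description _ H))
  | right _ => RtoC 0
  end.

Definition S_sum (f : nat -> C) (x : R) : C :=
  sum_n_m (fun n : nat => f (floorN (x / INR n))) 1 (floorN x).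

(* Main.v *)
(** Write [k] for the integer part of [(r - 1) / 2], [p = r + k + 1 = (3 r + eta) / 2]
    and [D = x ^ (1 / p)]. Grouping the [n] with the same quotient,
    [S = sum_d h(d) c(d ^ r)] where [c(m) = [x / m] - [x / (m + 1)]] differs from
    [x / (m (m + 1))] by at most 1. The [d <= D] contribute an error [D ^ (1 + alpha)].
    For [d > D] the error is negligible unless [c(d ^ r) > 0], that is unless [x / d ^ r]
    is barely above an integer. Such [d] are sparse: if [d < e = d + a <= 2 d] are two of
    them, the beta-type integral of [(e - s)^k (s - d)^k s^(r-k-1)] over [[d, e]] is,
    up to a constant, [P e^r - Q d^r] with integers [P, Q = O(d^k)] (Pade approximants).
    Multiplied by [x / (d^r e^r)] it becomes an integer plus an error which, for [a] larger
    than a constant, is less than half of it. So the integer is at least 1, and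
    [a^(2k+1) >> d^p / x]. Summing [d ^ alpha] over dyadic blocks with these gaps, the
    hypothesis on [alpha], which reads [(1 + alpha) (2 k + 1) < p], makes the sum geometric
    and hence [O(D ^ (1 + alpha))]. *)

Require Import Defs.
From Stdlib Require Import Reals ZArith Lra Lia ClassicalEpsilon.
From Coquelicot Require Import Coquelicot.

(** * Integer forms from beta integrals *)

(** The exponents [i] and [j] are kept apart, although the gap estimate takes both equal to [k],
    because integration by parts lowers them one at a time. *)
Definition beta_int (i j m : nat) (d e : R) : R :=
  RInt (fun s => (e - s) ^ i * (s - d) ^ j * s ^ m) d e.

Lemma continuous_beta_integrand (i j m : nat) (d e s : R) :
  continuous (fun s => (e - s) ^ i * (s - d) ^ j * s ^ m) s.
Proof. apply (ex_derive_continuous (V := R_NormedModule)). auto_derive. trivial. Qed.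

Lemma ex_RInt_beta_integrand (i j m : nat) (d e a b : R) :
  ex_RInt (fun s => (e - s) ^ i * (s - d) ^ j * s ^ m) a b.
Proof.
apply (ex_RInt_continuous (V := R_CompleteNormedModule)).
intros s _; apply continuous_beta_integrand.
Qed.

(** Integrate the derivative of [(e - s)^i (s - d)^j s^(m+1)] over the interval. The factors [0 ^ i]
    and [0 ^ j] are 1 for exponent 0, so the boundary terms need no case distinction. *)
Lemma beta_int_parts (i j m : nat) (d e : R) :
  INR (S m) * beta_int i j m d e =
  0 ^ i * (e - d) ^ j * e ^ S m - (e - d) ^ i * 0 ^ j * d ^ S m
  + INR i * beta_int (pred i) j (S m) d e - INR j * beta_int i (pred j) (S m) d e.
Proof.
set (f1 := fun s => (e - s) ^ i * (s - d) ^ j * s ^ m).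
set (f2 := fun s => (e - s) ^ pred i * (s - d) ^ j * s ^ S m).
set (f3 := fun s => (e - s) ^ i * (s - d) ^ pred j * s ^ S m).
set (G := fun s => (e - s) ^ i * (s - d) ^ j * s ^ S m).
assert (E1 : ex_RInt f1 d e) by apply ex_RInt_beta_integrand.
assert (E2 : ex_RInt f2 d e) by apply ex_RInt_beta_integrand.
assert (E3 : ex_RInt f3 d e) by apply ex_RInt_beta_integrand.
pose proof (is_RInt_scal _ _ _ (INR (S m)) _ (RInt_correct _ _ _ E1)) as I1.
pose proof (is_RInt_scal _ _ _ (INR i) _ (RInt_correct _ _ _ E2)) as I2.
pose proof (is_RInt_scal _ _ _ (INR j) _ (RInt_correct _ _ _ E3)) as I3.
pose proof (is_RInt_plus _ _ _ _ _ _ (is_RInt_minus _ _ _ _ _ _ I1 I2) I3) as I4.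
assert (I5 : is_RInt (fun s => INR (S m) * f1 s - INR i * f2 s + INR j * f3 s)
               d e (G e - G d)).
{ apply (is_RInt_derive (V := R_CompleteNormedModule) G).
  - intros s _; unfold G, f1, f2, f3; auto_derive; trivial.
    change (match m with 0%nat => 1 | S _ => INR m + 1 end) with (INR (S m)).
    unfold Rminus; rewrite S_INR; simpl pow. ring.
  - intros s _; apply (ex_derive_continuous (V := R_NormedModule)).
    unfold f1, f2, f3; auto_derive; trivial. }
assert (H := is_RInt_unique _ _ _ _ I4).
change (RInt (fun s => INR (S m) * f1 s - INR i * f2 s + INR j * f3 s) d e =
        INR (S m) * RInt f1 d e - INR i * RInt f2 d e + INR j * RInt f3 d e) in H.
rewrite (is_RInt_unique _ _ _ _ I5) in H.
unfold beta_int; fold f1 f2 f3.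
unfold G in H; rewrite !Rminus_diag in H.
lra.
Qed.

(** [v] is, up to a constant factor, an integral form
    [P e^(m+1+i) - Q d^(m+1+j)] whose coefficients have the size of
    homogeneous polynomials of degrees [j] and [i] in [d] and [e]. *)
Definition pade_form (i j m : nat) (v : R -> R -> R) : Prop :=
  exists (N : nat) (B : R), (1 <= N)%nat /\ 0 <= B /\
  forall d e : nat, (d <= e)%nat -> exists P Q : Z,
    Rabs (IZR P) <= B * INR e ^ j /\ Rabs (IZR Q) <= B * INR e ^ i /\
    INR N * v (INR d) (INR e)
      = IZR P * INR e ^ (m + 1 + i) - IZR Q * INR d ^ (m + 1 + j).

Lemma pade_form_ext (i j m : nat) (u v : R -> R -> R) :
  (forall d e, u d e = v d e) -> pade_form i j m u -> pade_form i j m v.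
Proof.
intros H (N & B & HN & HB & F); exists N, B; repeat split; trivial.
intros d e L; destruct (F d e L) as (P & Q & HP & HQ & E); exists P, Q.
rewrite <- H; auto.
Qed.

Lemma pade_form_lin (i j m : nat) (b : Z) (u v : R -> R -> R) :
  pade_form i j m u -> pade_form i j m v ->
  pade_form i j m (fun d e => u d e + IZR b * v d e).
Proof.
intros (N1 & B1 & HN1 & HB1 & F1) (N2 & B2 & HN2 & HB2 & F2).
exists (N1 * N2)%nat, (INR N2 * B1 + INR N1 * Rabs (IZR b) * B2).
assert (0 <= INR N1) by apply pos_INR. assert (0 <= INR N2) by apply pos_INR.
assert (0 <= Rabs (IZR b)) by apply Rabs_pos.
split; [nia|]; split.
{ apply Rplus_le_le_0_compat; repeat apply Rmult_le_pos; trivial. }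
intros d e L.
destruct (F1 d e L) as (P1 & Q1 & HP1 & HQ1 & E1).
destruct (F2 d e L) as (P2 & Q2 & HP2 & HQ2 & E2).
exists (Z.of_nat N2 * P1 + Z.of_nat N1 * b * P2)%Z, (Z.of_nat N2 * Q1 + Z.of_nat N1 * b * Q2)%Z.
assert (K : forall (p1 p2 : Z) t, Rabs (IZR p1) <= B1 * t -> Rabs (IZR p2) <= B2 * t ->
  Rabs (IZR (Z.of_nat N2 * p1 + Z.of_nat N1 * b * p2))
    <= (INR N2 * B1 + INR N1 * Rabs (IZR b) * B2) * t).
{ intros p1 p2 t h1 h2.
  rewrite plus_IZR, !mult_IZR, <- !INR_IZR_INZ.
  eapply Rle_trans; [apply Rabs_triang|].
  rewrite !Rabs_mult, !(Rabs_pos_eq (INR _)) by apply pos_INR.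
  rewrite Rmult_plus_distr_r, !Rmult_assoc.
  apply Rplus_le_compat; repeat apply Rmult_le_compat_l; trivial. }
repeat split; try (apply K; trivial).
rewrite !plus_IZR, !mult_IZR, <- !INR_IZR_INZ, mult_INR.
transitivity (INR N2 * (INR N1 * u (INR d) (INR e))
  + INR N1 * IZR b * (INR N2 * v (INR d) (INR e))); [ring|].
rewrite E1, E2; ring.
Qed.

(** The division by [m + 1] in each integration by parts is absorbed in the factor [N]; [P] and [Q]
    stay the same. *)
Lemma pade_form_div (i j m n : nat) (v : R -> R -> R) :
  pade_form i j m (fun d e => INR (S n) * v d e) -> pade_form i j m v.
Proof.
intros (N & B & HN & HB & F); exists (N * S n)%nat, B; split; [nia|split; trivial].
intros d e L; destruct (F d e L) as (P & Q & HP & HQ & E); exists P, Q.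
repeat split; trivial; rewrite <- E, mult_INR; ring.
Qed.

Lemma pow_diff_bound (d e j : nat) : (d <= e)%nat ->
  Rabs (IZR ((Z.of_nat e - Z.of_nat d) ^ Z.of_nat j)) <= INR e ^ j.
Proof.
intros L; rewrite <- pow_IZR, minus_IZR, <- !INR_IZR_INZ, <- RPow_abs.
apply pow_incr; split; [apply Rabs_pos|].
apply le_INR in L; pose proof (pos_INR d); rewrite Rabs_pos_eq; lra.
Qed.

Lemma pow_zero_bound (i : nat) : Rabs (IZR (0 ^ Z.of_nat i)) <= 1.
Proof.
rewrite <- pow_IZR; destruct i; simpl; [rewrite Rabs_R1|rewrite Rmult_0_l, Rabs_R0]; lra.
Qed.

Lemma pade_form_boundary (i j m : nat) :
  pade_form i j m (fun d e => 0 ^ i * (e - d) ^ j * e ^ S m - (e - d) ^ i * 0 ^ j * d ^ S m).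
Proof.
exists 1%nat, 1; split; [lia|]; split; [lra|]; intros d e L.
exists (0 ^ Z.of_nat i * (Z.of_nat e - Z.of_nat d) ^ Z.of_nat j)%Z,
       (0 ^ Z.of_nat j * (Z.of_nat e - Z.of_nat d) ^ Z.of_nat i)%Z.
rewrite !mult_IZR, !Rabs_mult.
pose proof (pow_zero_bound i); pose proof (pow_zero_bound j).
pose proof (pow_diff_bound d e j L); pose proof (pow_diff_bound d e i L).
split; [|split]; try (apply Rmult_le_compat; trivial; apply Rabs_pos).
rewrite <- !pow_IZR, !minus_IZR, <- !INR_IZR_INZ.
(* [0 ^ l] is nonzero only for [l = 0], where both exponents agree. *)
assert (Z : forall l t, 0 ^ l * t ^ (m + 1 + l) = 0 ^ l * t ^ S m).
{ intros [|l] t; [|simpl; rewrite !Rmult_0_l; ring].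
  replace (m + 1 + 0)%nat with (S m) by lia; trivial. }
replace (0 ^ i * (INR e - INR d) ^ j * INR e ^ (m + 1 + i))
   with ((INR e - INR d) ^ j * (0 ^ i * INR e ^ (m + 1 + i))) by ring.
replace (0 ^ j * (INR e - INR d) ^ i * INR d ^ (m + 1 + j))
   with ((INR e - INR d) ^ i * (0 ^ j * INR d ^ (m + 1 + j))) by ring.
rewrite !Z; simpl INR; ring.
Qed.

(** The exponent of [e] is unchanged and that of [d] drops by one. The spare factor [d <= e] moves
    into [Q], whose allowed degree [i] grows by one. *)
Lemma pade_form_lower_l (i j m : nat) (v : R -> R -> R) :
  pade_form i j (S m) v -> pade_form (S i) j m v.
Proof.
intros (N & B & HN & HB & F); exists N, B; split; [trivial|split; trivial].
intros d e L; destruct (F d e L) as (P & Q & HP & HQ & E).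
exists P, (Q * Z.of_nat d)%Z; split; [trivial|split].
- rewrite mult_IZR, Rabs_mult, <- INR_IZR_INZ, (Rabs_pos_eq (INR d)) by apply pos_INR.
  apply Rle_trans with (B * INR e ^ i * INR e); [|right; simpl; ring].
  apply Rmult_le_compat; trivial using Rabs_pos, pos_INR; apply le_INR, L.
- rewrite E, mult_IZR, <- INR_IZR_INZ.
  replace (S m + 1 + i)%nat with (m + 1 + S i)%nat by lia.
  replace (S m + 1 + j)%nat with (S (m + 1 + j)) by lia.
  simpl pow; ring.
Qed.

(** Mirror image: a spare factor [e] moves into [P]. *)
Lemma pade_form_lower_r (i j m : nat) (v : R -> R -> R) :
  pade_form i j (S m) v -> pade_form i (S j) m v.
Proof.
intros (N & B & HN & HB & F); exists N, B; split; [trivial|split; trivial].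
intros d e L; destruct (F d e L) as (P & Q & HP & HQ & E).
exists (P * Z.of_nat e)%Z, Q; split; [|split; trivial].
- rewrite mult_IZR, Rabs_mult, <- INR_IZR_INZ, (Rabs_pos_eq (INR e)) by apply pos_INR.
  apply Rle_trans with (B * INR e ^ j * INR e); [|right; simpl; ring].
  apply Rmult_le_compat_r; trivial using pos_INR.
- rewrite E, mult_IZR, <- INR_IZR_INZ.
  replace (S m + 1 + j)%nat with (m + 1 + S j)%nat by lia.
  replace (S m + 1 + i)%nat with (S (m + 1 + i)) by lia.
  simpl pow; ring.
Qed.

(** Strong induction on [i + j]: integration by parts lowers [i] or [j] and raises [m], and the two
    lowering lemmas bring the resulting forms back to the exponents [i], [j], [m]. *)
Lemma pade_form_beta_int (i j m : nat) : pade_form i j m (beta_int i j m).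
Proof.
remember (i + j)%nat as n eqn:En; revert i j m En.
induction n as [n IH] using (well_founded_induction lt_wf); intros i j m En.
apply pade_form_div with m.
apply pade_form_ext with (fun d e =>
  (0 ^ i * (e - d) ^ j * e ^ S m - (e - d) ^ i * 0 ^ j * d ^ S m)
  + IZR (Z.of_nat i) * beta_int (pred i) j (S m) d e
  + IZR (- Z.of_nat j) * beta_int i (pred j) (S m) d e).
{ intros d e; rewrite beta_int_parts, opp_IZR, <- !INR_IZR_INZ; ring. }
(* Since [pred 0 = 0], a term with a zero exponent does not decrease [i + j]; its coefficient is 0
   and it is dropped before the induction hypothesis is used. *)
destruct i as [|i], j as [|j].
- apply pade_form_ext with (2 := pade_form_boundary 0 0 m); intros; simpl; ring.
- apply pade_form_ext with (fun d e =>
    (0 ^ 0 * (e - d) ^ S j * e ^ S m - (e - d) ^ 0 * 0 ^ S j * d ^ S m)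
    + IZR (- Z.of_nat (S j)) * beta_int 0 j (S m) d e).
  { intros; change (IZR (Z.of_nat 0)) with 0; change (IZR (- Z.of_nat 0)) with 0;
    cbn [Nat.pred]; ring. }
  apply pade_form_lin; [apply pade_form_boundary|].
  apply pade_form_lower_r, (IH j); lia.
- apply pade_form_ext with (fun d e =>
    (0 ^ S i * (e - d) ^ 0 * e ^ S m - (e - d) ^ S i * 0 ^ 0 * d ^ S m)
    + IZR (Z.of_nat (S i)) * beta_int i 0 (S m) d e).
  { intros; change (IZR (Z.of_nat 0)) with 0; change (IZR (- Z.of_nat 0)) with 0;
    cbn [Nat.pred]; ring. }
  apply pade_form_lin; [apply pade_form_boundary|].
  apply pade_form_lower_l, (IH i); lia.
- apply pade_form_lin; [apply pade_form_lin; [apply pade_form_boundary|]|].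
  + apply pade_form_lower_l, (IH (i + S j)%nat); lia.
  + apply pade_form_lower_r, (IH (S i + j)%nat); lia.
Qed.

(** * Size of the beta integral *)

Lemma beta_int_upper (i j m : nat) (d e : R) : 0 <= d <= e ->
  beta_int i j m d e <= (e - d) ^ (i + j + 1) * e ^ m.
Proof.
intros H; unfold beta_int.
apply Rle_trans with (RInt (fun _ => (e - d) ^ (i + j) * e ^ m) d e).
- apply RInt_le; [lra|apply ex_RInt_beta_integrand|apply ex_RInt_const|].
  intros s Hs; rewrite pow_add.
  repeat apply Rmult_le_compat; repeat apply Rmult_le_pos; try apply pow_le;
    try apply pow_incr; lra.
- rewrite RInt_const; unfold scal; simpl; unfold mult; simpl.
  rewrite (pow_add _ (i + j) 1); right; simpl; ring.
Qed.

(** The integrand is nonnegative, and on the second quarter of the interval both [e - s] and [s - d]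
    are at least [(e - d) / 4]. *)
Lemma beta_int_lower (i j m : nat) (d e : R) : 0 <= d <= e ->
  (/ 4) ^ (i + j + 1) * (e - d) ^ (i + j + 1) * d ^ m <= beta_int i j m d e.
Proof.
intros H; unfold beta_int.
set (f := fun s => (e - s) ^ i * (s - d) ^ j * s ^ m).
set (a := d + (e - d) / 4); set (b := d + (e - d) / 2).
assert (X : forall u v, ex_RInt f u v) by (intros; apply ex_RInt_beta_integrand).
assert (Pos : forall s, d <= s <= e -> 0 <= f s).
{ intros s Hs; unfold f; repeat apply Rmult_le_pos; apply pow_le; lra. }
assert (E : RInt f d e = RInt f d a + RInt f a b + RInt f b e).
{ rewrite <- (RInt_Chasles f d b e), <- (RInt_Chasles f d a b) by apply X; reflexivity. }
assert (0 <= RInt f d a) by (apply RInt_ge_0; trivial; unfold a, b; intros; try apply Pos; lra).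
assert (0 <= RInt f b e) by (apply RInt_ge_0; trivial; unfold a, b; intros; try apply Pos; lra).
assert (RInt (fun _ => ((e - d) / 4) ^ (i + j) * d ^ m) a b <= RInt f a b).
{ apply RInt_le; [unfold a, b; lra|apply ex_RInt_const|apply X|].
  unfold a, b; intros s Hs; unfold f; rewrite pow_add.
  repeat apply Rmult_le_compat; repeat apply Rmult_le_pos; try apply pow_le;
    try apply pow_incr; lra. }
rewrite RInt_const in H2; unfold scal in H2; simpl in H2; unfold mult in H2; simpl in H2.
replace (b - a) with ((e - d) / 4) in H2 by (unfold a, b; lra).
rewrite <- Rpow_mult_distr.
replace (/ 4 * (e - d)) with ((e - d) / 4) by lra.
replace (i + j + 1)%nat with (S (i + j)) by lia; simpl pow; lra.
Qed.

(** * Gaps between near powers *)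

(** [d] is near if some integer part [floor (x / n)] equals [d ^ r]. *)
Definition near_power (x : R) (r d : nat) : Prop :=
  exists n : nat, INR n * INR d ^ r <= x < INR n * (INR d ^ r + 1).

(** The choice [m = r - 1 - k] makes the integral form [P e^r - Q d^r]. Times [x], it is an integer
    multiple of [d^r e^r] up to an error below half its size; being positive, it is at least a
    constant times [d^r e^r]. *)
Lemma near_power_gap (r k : nat) : (2 * k + 1 <= r)%nat ->
  exists (A : nat) (c : R), (1 <= A)%nat /\ 0 < c /\
  forall (x : R) (d e : nat), 0 < x -> (1 <= d)%nat -> (d < e <= 2 * d)%nat ->
    near_power x r d -> near_power x r e -> (A <= e - d)%nat ->
    c * INR d ^ (r + k + 1) <= x * INR (e - d) ^ (2 * k + 1).
Proof.
intros Hr.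
destruct (pade_form_beta_int k k (r - 1 - k)) as (N & B & HN & HB & F).
set (m := (r - 1 - k)%nat) in *.
set (kap := (/ 4) ^ (k + k + 1)).
assert (Hkap : 0 < kap) by (apply pow_lt; lra).
(* [C1 d^k x] will bound the error: [2 ^ k] comes from [e^k <= (2 d)^k], and [2 ^ r + 1] from the
   two remainder terms, at most [2 ^ r x] and [x]. *)
set (C1 := B * 2 ^ k * (2 ^ r + 1)).
assert (HNr : 1 <= INR N) by (apply (le_INR 1); lia).
assert (P2 : forall l, 0 < 2 ^ l) by (intros; apply pow_lt; lra).
assert (HC1 : 0 <= C1).
{ unfold C1; pose proof (P2 k); pose proof (P2 r).
  repeat apply Rmult_le_pos; lra. }
(* A gap [a >= A] gives [kap a >= 2 C1], which makes the form at least twice the error. *)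
destruct (INR_unbounded (2 * C1 / kap + 1)) as [A HA].
exists A, (/ (2 * INR N * 2 ^ m)).
assert (Hquot : 0 <= 2 * C1 / kap) by (apply Rdiv_le_0_compat; lra).
split; [apply INR_le; simpl INR at 1; lra|].
split; [apply Rinv_0_lt_compat; pose proof (P2 m); apply Rmult_lt_0_compat; lra|].
intros x d e Hx Hd Hde (n1 & H1l & H1u) (n2 & H2l & H2u) HAa.
destruct (F d e) as (P & Q & HP & HQ & E); [lia|].
replace (m + 1 + k)%nat with r in E by lia.
rewrite minus_INR by lia.
set (dd := INR d) in *; set (ee := INR e) in *.
assert (Hd1 : 1 <= dd) by (apply (le_INR 1); lia).
assert (Hlt : dd + 1 <= ee) by (unfold dd, ee; rewrite <- S_INR; apply le_INR; lia).
assert (Hle : ee <= 2 * dd)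
  by (unfold dd, ee; change 2 with (INR 2); rewrite <- mult_INR; apply le_INR; lia).
assert (Ha : INR A <= ee - dd) by (unfold ee, dd; rewrite <- minus_INR by lia; apply le_INR, HAa).
set (a := ee - dd) in *.
assert (Hdp : forall l, 1 <= dd ^ l) by (intros; apply pow_R1_Rle; trivial).
assert (Hep : forall l, dd ^ l <= ee ^ l <= 2 ^ l * dd ^ l).
{ intros; rewrite <- Rpow_mult_distr; split; apply pow_incr; lra. }
assert (Hup := beta_int_upper k k m dd ee ltac:(lra)).
assert (Hlo := beta_int_lower k k m dd ee ltac:(lra)).
fold a kap in Hup, Hlo.
set (I := beta_int k k m dd ee) in *.
replace (2 * k + 1)%nat with (k + k + 1)%nat by lia.
set (q := (k + k + 1)%nat) in *.
(* Nearness says [0 <= t1 < n1] and [0 <= t2 < n2]. In [Main], [x] is replaced by [n1 d^r + t1]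
   beside [P] and by [n2 e^r + t2] beside [Q]. *)
set (t1 := x - INR n1 * dd ^ r); set (t2 := x - INR n2 * ee ^ r).
assert (Main : INR N * I * x =
  IZR (P * Z.of_nat n1 - Q * Z.of_nat n2) * (dd ^ r * ee ^ r)
  + (IZR P * ee ^ r * t1 - IZR Q * dd ^ r * t2)).
{ rewrite E, minus_IZR, !mult_IZR, <- !INR_IZR_INZ; unfold t1, t2; ring. }
assert (Pn1 := pos_INR n1). assert (Pn2 := pos_INR n2).
assert (E1 : Rabs (IZR P * ee ^ r * t1) <= B * (2 ^ k * dd ^ k) * (2 ^ r * x)).
{ rewrite Rmult_assoc, Rabs_mult.
  pose proof (Hdp r); pose proof (Hep r); pose proof (Hep k); pose proof (P2 r).
  apply Rmult_le_compat; try apply Rabs_pos.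
  - apply Rle_trans with (1 := HP); apply Rmult_le_compat_l; lra.
  - assert (T : 0 <= t1 <= INR n1) by (unfold t1; lra).
    rewrite Rabs_pos_eq by (apply Rmult_le_pos; lra).
    apply Rle_trans with (2 ^ r * dd ^ r * INR n1).
    + apply Rmult_le_compat; lra.
    + rewrite Rmult_assoc; apply Rmult_le_compat_l; lra. }
assert (E2 : Rabs (IZR Q * dd ^ r * t2) <= B * (2 ^ k * dd ^ k) * x).
{ rewrite Rmult_assoc, Rabs_mult.
  pose proof (Hdp r); pose proof (Hep r); pose proof (Hep k).
  apply Rmult_le_compat; try apply Rabs_pos.
  - apply Rle_trans with (1 := HQ); apply Rmult_le_compat_l; lra.
  - assert (T : 0 <= t2 <= INR n2) by (unfold t2; lra).
    rewrite Rabs_pos_eq by (apply Rmult_le_pos; lra).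
    apply Rle_trans with (ee ^ r * INR n2); [|lra].
    apply Rmult_le_compat; lra. }
assert (Err : Rabs (IZR P * ee ^ r * t1 - IZR Q * dd ^ r * t2) <= C1 * dd ^ k * x).
{ eapply Rle_trans; [apply Rabs_triang|]; rewrite Rabs_Ropp; unfold C1.
  eapply Rle_trans; [apply Rplus_le_compat; eassumption|]; right; ring. }
assert (Ha1 : 1 <= a) by lra.
assert (Haq : a <= a ^ q).
{ replace q with (S (k + k)) by lia; simpl.
  pose proof (pow_R1_Rle a (k + k) Ha1).
  rewrite <- (Rmult_1_r a) at 1; apply Rmult_le_compat_l; lra. }
(* [2 k + 1 <= r] gives [k <= m], so the form, of size [a^q d^m], dominates the error, of size
   [d^k]. *)
assert (Hdk : dd ^ k <= dd ^ m) by (apply Rle_pow; trivial; lia).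
assert (Err2 : 2 * (C1 * dd ^ k * x) <= INR N * I * x).
{ rewrite <- Rmult_assoc; apply Rmult_le_compat_r; [lra|].
  apply Rle_trans with (1 * I); [|apply Rmult_le_compat_r; trivial].
  2:{ eapply Rle_trans; [|exact Hlo]. pose proof (Hdp m).
      repeat apply Rmult_le_pos; lra. }
  rewrite Rmult_1_l; eapply Rle_trans; [|exact Hlo].
  rewrite <- Rmult_assoc; pose proof (Hdp k); apply Rmult_le_compat; try lra.
  apply Rle_trans with (kap * a); [|apply Rmult_le_compat_l; lra].
  replace (2 * C1) with (kap * (2 * C1 / kap)) by (field; lra).
  apply Rmult_le_compat_l; lra. }
apply Rabs_le_between in Err.
assert (HI : 0 < I).
{ eapply Rlt_le_trans; [|exact Hlo]. pose proof (Hdp m).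
  repeat apply Rmult_lt_0_compat; lra. }
assert (HNI : 0 < INR N * I * x) by (repeat apply Rmult_lt_0_compat; lra).
assert (Hde2 : 0 < dd ^ r * ee ^ r).
{ pose proof (Hdp r); pose proof (Hep r); apply Rmult_lt_0_compat; lra. }
set (z := (P * Z.of_nat n1 - Q * Z.of_nat n2)%Z) in *.
(* the form is positive, and its integer part [z] carries at least half of it *)
assert (Hz : (1 <= z)%Z).
{ apply (Zlt_le_succ 0), lt_IZR, Rmult_lt_reg_r with (1 := Hde2); lra. }
apply IZR_le in Hz.
assert (Hfin : dd ^ r * ee ^ r <= 2 * INR N * a ^ q * ee ^ m * x).
{ apply Rle_trans with (2 * (INR N * I * x)).
  - apply Rle_trans with (IZR z * (dd ^ r * ee ^ r)); [|lra].
    rewrite <- (Rmult_1_l (dd ^ r * _)) at 1; apply Rmult_le_compat_r; lra.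
  - replace (2 * INR N * a ^ q * ee ^ m * x) with (2 * (INR N * (a ^ q * ee ^ m) * x)) by ring.
    apply Rmult_le_compat_l; [lra|]; apply Rmult_le_compat_r; [lra|].
    apply Rmult_le_compat_l; lra. }
assert (Hm : 0 < 2 ^ m) by apply P2.
apply Rmult_le_reg_l with (2 * INR N * 2 ^ m); [repeat apply Rmult_lt_0_compat; lra|].
rewrite <- Rmult_assoc, Rinv_r, Rmult_1_l
  by (apply Rgt_not_eq; repeat apply Rmult_lt_0_compat; lra).
apply Rmult_le_reg_r with (dd ^ m); [pose proof (Hdp m); lra|].
rewrite <- pow_add; replace (r + k + 1 + m)%nat with (r + r)%nat by lia; rewrite pow_add.
apply Rle_trans with (dd ^ r * ee ^ r).
- pose proof (Hdp r); pose proof (Hep r); apply Rmult_le_compat_l; lra.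
- apply Rle_trans with (1 := Hfin).
  replace (2 * INR N * 2 ^ m * (x * a ^ q) * dd ^ m)
    with (2 * INR N * a ^ q * x * (2 ^ m * dd ^ m)) by ring.
  replace (2 * INR N * a ^ q * ee ^ m * x) with (2 * INR N * a ^ q * x * ee ^ m) by ring.
  apply Rmult_le_compat_l; [repeat apply Rmult_le_pos; lra|apply Hep].
Qed.

(** * Counting a set with gaps *)

(** Writing ranges as half-open intervals, from [S a] to [b], makes blocks adjoin exactly and allows
    empty ones. *)
Lemma Rsum_split (u : nat -> R) (a b c : nat) : (a <= b <= c)%nat ->
  sum_n_m u (S a) c = sum_n_m u (S a) b + sum_n_m u (S b) c.
Proof. intros H; apply (sum_n_m_Chasles u); lia. Qed.

Lemma Rsum_le (u v : nat -> R) (a b : nat) :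
  (forall n, (a <= n <= b)%nat -> u n <= v n) -> sum_n_m u a b <= sum_n_m v a b.
Proof.
intros H; destruct (le_lt_dec a b) as [L|L]; [|rewrite !sum_n_m_zero by trivial; apply Rle_refl].
induction b as [|b IH].
- replace a with 0%nat in * by lia; rewrite !sum_n_n; apply H; lia.
- rewrite !sum_n_Sm by lia; apply Rplus_le_compat; [|apply H; lia].
  destruct (le_lt_dec a b) as [L'|L'].
  + apply IH; trivial; intros; apply H; lia.
  + rewrite !sum_n_m_zero by trivial; apply Rle_refl.
Qed.

Lemma Rsum_ge_0 (u : nat -> R) (a b : nat) :
  (forall n, (a <= n <= b)%nat -> 0 <= u n) -> 0 <= sum_n_m u a b.
Proof.
intros H; apply Rle_trans with (sum_n_m (fun _ => 0) a b); [|apply Rsum_le, H].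
rewrite sum_n_m_const; lra.
Qed.

Lemma Rsum_le_const (u : nat -> R) (a b : nat) (B : R) :
  (forall n, (a <= n <= b)%nat -> u n <= B) -> sum_n_m u a b <= INR (S b - a) * B.
Proof. intros H; rewrite <- sum_n_m_const; apply Rsum_le, H. Qed.

Lemma Rsum_scal_l (l : R) (u : nat -> R) (a b : nat) :
  sum_n_m (fun n => l * u n) a b = l * sum_n_m u a b.
Proof. apply (sum_n_m_mult_l (K := R_Ring)). Qed.

Lemma Rsum_plus (u v : nat -> R) (a b : nat) :
  sum_n_m (fun n => u n + v n) a b = sum_n_m u a b + sum_n_m v a b.
Proof. apply (sum_n_m_plus (G := R_AbelianMonoid)). Qed.

Definition indic (P : Prop) : R := if excluded_middle_informative P then 1 else 0.

Lemma indic_bounds (P : Prop) : 0 <= indic P <= 1.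
Proof. unfold indic; destruct excluded_middle_informative; lra. Qed.

Lemma indic_true (P : Prop) : P -> indic P = 1.
Proof. unfold indic; destruct excluded_middle_informative; tauto. Qed.

Lemma indic_false (P : Prop) : ~ P -> indic P = 0.
Proof. unfold indic; destruct excluded_middle_informative; tauto. Qed.

(** Two members of the window differ by less than [n <= L], hence by less than [A]. So all members
    lie among the [A] integers starting at the first one, which the induction locates. *)
Lemma count_window (P : nat -> Prop) (A L n s : nat) : (1 <= A)%nat -> (n <= L)%nat ->
  (forall d e, (s < d)%nat -> (d < e <= s + n)%nat -> P d -> P e ->
     (A <= e - d)%nat -> (L <= e - d)%nat) ->
  sum_n_m (fun d => indic (P d)) (S s) (s + n) <= INR A.
Proof.
intros HA; revert s; induction n as [|n IH]; intros s HL gap.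
{ rewrite sum_n_m_zero by lia; apply pos_INR. }
destruct (excluded_middle_informative (P (S s))) as [H|H].
- assert (B : forall a b, (a <= b)%nat ->
    sum_n_m (fun d => indic (P d)) (S a) b <= INR (b - a)).
  { intros a b Lab; eapply Rle_trans; [apply Rsum_le_const; intros; apply indic_bounds|].
    rewrite Rmult_1_r; apply Rle_refl. }
  destruct (le_lt_dec (S n) A) as [LA|LA].
  + eapply Rle_trans; [apply B; lia|apply le_INR; lia].
  + rewrite (Rsum_split _ s (s + A)) by lia.
    rewrite <- (Rplus_0_r (INR A)); apply Rplus_le_compat.
    * eapply Rle_trans; [apply B; lia|apply le_INR; lia].
    * eapply Rle_trans; [apply Rsum_le_const with (B := 0)|lra].
      intros d Hd; rewrite indic_false; [lra|]; intros Pd.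
      specialize (gap (S s) d ltac:(lia) ltac:(lia) H Pd); lia.
- rewrite (Rsum_split _ s (S s)), sum_n_n, indic_false, Rplus_0_l by (trivial; lia).
  replace (s + S n)%nat with (S s + n)%nat in * by lia.
  apply IH; [lia|]; intros d e Hd; apply gap; lia.
Qed.

(** Cover the interval by windows of length the ceiling of [L]; each holds at most [A] members. *)
Lemma count_gap (P : nat -> Prop) (A : nat) (L : R) (a b : nat) :
  (1 <= A)%nat -> 0 < L -> (a <= b)%nat ->
  (forall d e, (a < d)%nat -> (d < e <= b)%nat -> P d -> P e ->
     (A <= e - d)%nat -> L <= INR (e - d)) ->
  sum_n_m (fun d => indic (P d)) (S a) b <= INR A * (INR (b - a) / L + 1).
Proof.
intros HA HL Hab gap.
destruct (nfloor_ex L) as [l Hl]; [lra|].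
(* The ceiling of [L]; [HM] is its defining property. *)
set (M := if Req_EM_T (INR l) L then l else S l).
assert (HM : forall n, L <= INR n <-> (M <= n)%nat).
{ intros n; unfold M; destruct (Req_EM_T (INR l) L) as [<-|Hn].
  - split; [apply INR_le|apply le_INR].
  - split; intros H.
    + apply INR_lt; lra.
    + apply le_INR in H; rewrite S_INR in H; lra. }
assert (M1 : (1 <= M)%nat).
{ destruct M; [|lia]. pose proof (proj2 (HM 0%nat)); specialize (H (le_n 0)); simpl in H; lra. }
assert (LM : L <= INR M) by (apply HM; lia).
assert (W : forall n c, (a <= c <= b)%nat -> (c <= a + n * M)%nat ->
   sum_n_m (fun d => indic (P d)) (S a) c <= INR A * INR n).
{ induction n as [|n IH]; intros c Hc Hcn.
  - rewrite sum_n_m_zero by lia; apply Rmult_le_pos; apply pos_INR.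
  - assert (exists c', (a <= c' <= c)%nat /\ (c' <= a + n * M)%nat /\ (c - c' <= M)%nat)
      as (c' & H1 & H2 & H3).
    { simpl in Hcn; destruct (le_lt_dec c (a + M)); [exists a|exists (c - M)%nat]; nia. }
    rewrite (Rsum_split _ a c') by lia; rewrite S_INR, Rmult_plus_distr_l, Rmult_1_r.
    apply Rplus_le_compat; [apply IH; lia|].
    replace c with (c' + (c - c'))%nat at 1 by lia.
    apply count_window with M; trivial.
    intros d e Hd He Pd Pe HAde; apply HM, gap; trivial; lia. }
eapply Rle_trans; [apply (W (S ((b - a) / M)))|].
- lia.
- pose proof (Nat.div_mod_eq (b - a) M); pose proof (Nat.mod_upper_bound (b - a) M); nia.
- apply Rmult_le_compat_l; [apply pos_INR|]; rewrite S_INR; apply Rplus_le_compat_r.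
  apply Rmult_le_reg_r with (INR M); [lra|].
  apply Rle_trans with (INR (b - a)).
  + rewrite <- mult_INR; apply le_INR; rewrite Nat.mul_comm; apply Nat.Div0.mul_div_le.
  + unfold Rdiv; rewrite Rmult_assoc, <- (Rmult_1_r (INR (b - a))) at 1.
    apply Rmult_le_compat_l; [apply pos_INR|].
    apply Rmult_le_reg_l with L; trivial.
    rewrite <- Rmult_assoc, Rinv_r by lra; lra.
Qed.

(** * Dyadic blocks *)

Lemma floorN_spec (t : R) : 0 <= t -> INR (floorN t) <= t < INR (floorN t) + 1.
Proof.
intros H; unfold floorN; pose proof (base_Int_part t) as [H1 H2].
assert (-1 < Int_part t)%Z by (apply lt_IZR; simpl; lra).
rewrite INR_IZR_INZ, Z2Nat.id by lia; lra.
Qed.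

Lemma floorN_ge (t : R) (n : nat) : 0 <= t -> (n <= floorN t)%nat <-> INR n <= t.
Proof.
intros H; pose proof (floorN_spec t H); split; intros Hn.
- apply le_INR in Hn; lra.
- apply Nat.lt_succ_r, INR_lt; rewrite S_INR; lra.
Qed.

Lemma floorN_lt (t : R) (n : nat) : 0 <= t -> (floorN t < n)%nat <-> t < INR n.
Proof.
intros H; pose proof (floorN_ge t n H); split; intros Hn.
- apply Rnot_le_lt; intros F; apply H0 in F; lia.
- apply Nat.nle_gt; intros F; apply H0 in F; lra.
Qed.

Lemma exp_mono (s t : R) : s <= t -> exp s <= exp t.
Proof. intros [H| ->]; [left; apply exp_increasing, H|apply Rle_refl]. Qed.

Lemma pow_exp (t : R) (n : nat) : exp t ^ n = exp (INR n * t).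
Proof.
rewrite <- Rpower_pow by apply exp_pos; unfold Rpower; rewrite ln_exp; reflexivity.
Qed.

Lemma near_power_le (x : R) (r d : nat) : 0 <= x -> near_power x r d -> INR d ^ r <= x.
Proof.
intros Hx (n & H1 & H2).
assert (0 <= INR d ^ r) by (apply pow_le, pos_INR).
destruct n as [|n]; [simpl in H2; lra|].
rewrite S_INR in H1; pose proof (pos_INR n); nra.
Qed.

(** In the coordinates [l = ln D] and [v = ln (y / D)], where [x = D^p], estimates between powers
    become linear inequalities between exponents. The factor [exp (- delta * v)] is what makes the
    sum over blocks converge. *)
Lemma block_bound (r k : nat) (alpha : R) :
  (2 * k + 1 <= r)%nat -> 0 <= alpha ->
  (1 + alpha) * INR (2 * k + 1) < INR (r + k + 1) ->
  exists K delta : R, 0 <= K /\ 0 < delta /\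
  forall l v : R, 0 <= l -> 0 <= v ->
  let x := exp (INR (r + k + 1) * l) in
  let y := exp (l + v) in
  sum_n_m (fun d => Rpower (INR d) alpha * (indic (near_power x r d) + x / INR d ^ (2 * r)))
    (S (floorN y)) (floorN (2 * y))
  <= K * exp ((1 + alpha) * l - delta * v).
Proof.
intros Hr Ha Hq.
destruct (near_power_gap r k Hr) as (A & c & HA & Hc & gap).
set (q := (2 * k + 1)%nat) in *; set (p := (r + k + 1)%nat) in *.
assert (Q1 : 1 <= INR q) by (apply (le_INR 1); unfold q; lia).
assert (PR : INR p <= 2 * INR r).
{ replace 2 with (INR 2) by trivial; rewrite <- mult_INR; apply le_INR; unfold p; lia. }
assert (R1 : INR q <= INR r) by (apply le_INR, Hr).
assert (P0 : 1 <= INR p) by (apply (le_INR 1); unfold p; lia).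
assert (Q0 : INR p = INR r + INR k + 1) by (unfold p; rewrite !plus_INR; trivial).
assert (Qk : INR q = 2 * INR k + 1) by (unfold q; rewrite plus_INR, mult_INR; trivial).
pose proof (pos_INR k) as K0.
assert (Hgq : 1 + alpha < INR p / INR q)
  by (apply Rmult_lt_reg_r with (INR q); [lra|]; field_simplify; lra).
(* As [p - r = k + 1], this says [alpha (k + 1) < r]; the hypothesis gives the stronger
   [alpha (2 k + 1) < r - k]. *)
assert (Hbp : alpha < INR r * (1 + alpha) / INR p).
{ apply Rmult_lt_reg_r with (INR p); [lra|]; field_simplify; [|lra].
  pose proof (Rmult_le_pos _ _ Ha K0); rewrite Q0; rewrite Q0, Qk in Hq; lra. }
(* The first entry is the saving from the gaps, the second the saving on the extra [+ 1] in
   [count_gap]. *)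
set (delta := Rmin (INR p / INR q - (1 + alpha)) (INR r * (1 + alpha) / INR p - alpha)).
assert (D1 : delta <= INR p / INR q - (1 + alpha)) by apply Rmin_l.
assert (D2 : delta <= INR r * (1 + alpha) / INR p - alpha) by apply Rmin_r.
assert (D0 : 0 < delta) by (apply Rmin_glb_lt; lra).
set (T := Rpower 2 alpha).
assert (T0 : 0 < T) by apply exp_pos.
pose proof (pos_INR A) as A0.
assert (E0 := exp_pos (- (ln c / INR q))).
exists (T * (INR A * (2 * exp (- (ln c / INR q)) + 1) + 2)), delta.
split; [apply Rmult_le_pos; [lra|]; apply Rplus_le_le_0_compat; [apply Rmult_le_pos|]; lra|].
split; [trivial|]; intros l v Hl Hv; cbv zeta.
set (x := exp (INR p * l)); set (y := exp (l + v)).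
assert (X0 : 0 < x) by apply exp_pos.
assert (Y1 : 1 <= y) by (rewrite <- exp_0; apply exp_mono; lra).
set (a := floorN y); set (b := floorN (2 * y)).
assert (Hab : (a <= b)%nat).
{ apply floorN_ge; [lra|]; pose proof (floorN_spec y); unfold a; lra. }
assert (Hba : INR (b - a) <= 2 * y).
{ rewrite minus_INR by trivial; pose proof (floorN_spec y); pose proof (floorN_spec (2 * y)).
  unfold a, b; lra. }
assert (HB : forall d, (S a <= d <= b)%nat -> y < INR d <= 2 * y).
{ intros d Hd; split; [apply floorN_lt|apply floorN_ge]; try lra; unfold a, b in *; lia. }
assert (HT : forall d, (S a <= d <= b)%nat -> Rpower (INR d) alpha <= T * exp (alpha * (l + v))).
{ intros d Hd; apply HB in Hd.
  apply Rle_trans with (Rpower (2 * y) alpha); [apply Rle_Rpower_l; lra|].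
  unfold T; rewrite <- Rpower_mult_distr by lra.
  unfold y; unfold Rpower at 2; rewrite ln_exp; lra. }
set (Z := exp ((1 + alpha) * l - delta * v)).
assert (Z0 : 0 < Z) by apply exp_pos.
set (W := T * exp (alpha * (l + v))) in *.
assert (W0 : 0 < W) by (apply Rmult_lt_0_compat; [trivial|apply exp_pos]).
assert (S1 : W * sum_n_m (fun d => indic (near_power x r d)) (S a) b
             <= T * (INR A * (2 * exp (- (ln c / INR q)) + 1)) * Z).
(* A block with a near power satisfies [y^r <= x]. This bound on [v] controls the [+ 1] in
   [count_gap]; the other blocks contribute 0. *)
{ destruct (excluded_middle_informative (exists d, (S a <= d <= b)%nat /\ near_power x r d))
    as [(d & Hd & Nd)|Hno].
  - assert (Hy : INR r * (l + v) <= INR p * l).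
    { apply near_power_le in Nd; [|lra]. apply HB in Hd.
      assert (H : y ^ r <= x) by (apply Rle_trans with (2 := Nd); apply pow_incr; lra).
      unfold y, x in H; rewrite pow_exp in H.
      apply Rnot_lt_le; intros F; apply exp_increasing in F; lra. }
    (* The gap lemma reads [a^q >= c y^p / x = c exp (p v)]; [L] is the [q]-th root of the right
       side. *)
    set (L := exp ((ln c + INR p * v) / INR q)).
    assert (HL : sum_n_m (fun d => indic (near_power x r d)) (S a) b
                 <= INR A * (INR (b - a) / L + 1)).
    { apply count_gap; trivial; [apply exp_pos|].
      intros d1 d2 Hd1 Hd2 N1 N2 HAd.
      assert (B1 : y < INR d1 <= 2 * y) by (apply HB; lia).
      assert (B2 : y < INR d2 <= 2 * y) by (apply HB; lia).
      assert (G : c * INR d1 ^ p <= x * INR (d2 - d1) ^ q).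
      { apply gap; trivial; try lia.
        split; [lia|]; apply INR_le; rewrite mult_INR; simpl; lra. }
      assert (a1 : 0 < INR (d2 - d1)) by (apply (lt_INR 0); lia).
      rewrite <- (exp_ln (INR (d2 - d1))) in G by trivial.
      rewrite <- (exp_ln c) in G by trivial.
      assert (Yp : y ^ p <= INR d1 ^ p) by (apply pow_incr; lra).
      assert (G2 : exp (ln c) * y ^ p <= x * exp (ln (INR (d2 - d1))) ^ q).
      { apply Rle_trans with (2 := G); apply Rmult_le_compat_l; [left; apply exp_pos|trivial]. }
      unfold x, y in G2; rewrite !pow_exp, <- !exp_plus in G2.
      unfold L; rewrite <- (exp_ln (INR (d2 - d1))) by trivial; apply exp_mono.
      apply Rmult_le_reg_r with (INR q); [lra|]; field_simplify; [|lra].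
      apply Rnot_lt_le; intros F.
      assert (F2 : INR p * l + INR q * ln (INR (d2 - d1)) < ln c + INR p * (l + v)) by lra.
      apply exp_increasing in F2; lra. }
    apply Rle_trans with (W * (INR A * (2 * y / L + 1))).
    { apply Rmult_le_compat_l; [lra|]; apply Rle_trans with (1 := HL).
      apply Rmult_le_compat_l; [trivial|]; apply Rplus_le_compat_r.
      apply Rmult_le_compat_r; [left; apply Rinv_0_lt_compat, exp_pos|trivial]. }
    replace (2 * y / L) with (2 * exp (- (ln c / INR q)) * exp (l + v - INR p / INR q * v)).
    2:{ unfold y, L, Rdiv at 3; rewrite <- exp_Ropp, !Rmult_assoc, <- !exp_plus.
        f_equal; f_equal; field; lra. }
    unfold W.
    replace (T * exp (alpha * (l + v)) * (INR A *
       (2 * exp (- (ln c / INR q)) * exp (l + v - INR p / INR q * v) + 1)))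
     with (T * (INR A * (2 * exp (- (ln c / INR q)) *
       (exp (alpha * (l + v)) * exp (l + v - INR p / INR q * v)) + exp (alpha * (l + v))))) by ring.
    rewrite <- exp_plus.
    assert (e1 : exp (alpha * (l + v) + (l + v - INR p / INR q * v)) <= Z) by (apply exp_mono; nra).
    assert (e2 : exp (alpha * (l + v)) <= Z).
    { apply exp_mono.
      assert (INR r * (1 + alpha) / INR p * (l + v) <= (1 + alpha) * l).
      { apply Rmult_le_reg_r with (INR p); [lra|]; field_simplify; [|lra]. nra. }
      nra. }
    rewrite !Rmult_assoc; apply Rmult_le_compat_l; [lra|]; apply Rmult_le_compat_l; [trivial|].
    rewrite Rmult_plus_distr_r, Rmult_1_l; apply Rplus_le_compat; [|trivial].
    rewrite <- Rmult_assoc; apply Rmult_le_compat_l; lra.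
  - rewrite (sum_n_m_ext_loc _ (fun _ => 0)).
    + rewrite sum_n_m_const, !Rmult_0_r; repeat apply Rmult_le_pos; lra.
    + intros d Hd; apply indic_false; intros N; apply Hno; eauto. }
(* At most [2 y] terms, each at most [x y^(-2r)]. The exponents compare because [p <= 2 r] and
   [1 + alpha + delta <= p / q <= p]. *)
assert (S2 : W * sum_n_m (fun d => x / INR d ^ (2 * r)) (S a) b <= T * 2 * Z).
{ apply Rle_trans with (W * (2 * y * (x * exp (- (INR (2 * r) * (l + v)))))).
  - apply Rmult_le_compat_l; [lra|].
    eapply Rle_trans; [apply Rsum_le_const with (B := x * exp (- (INR (2 * r) * (l + v))))|].
    + intros d Hd; apply Rmult_le_compat_l; [lra|].
      rewrite exp_Ropp, <- pow_exp; apply HB in Hd.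
      apply Rinv_le_contravar; [apply pow_lt; fold y; lra|apply pow_incr; fold y; lra].
    + apply Rmult_le_compat_r; [left; apply Rmult_lt_0_compat; [lra|apply exp_pos]|].
      replace (S b - S a)%nat with (b - a)%nat by lia; trivial.
  - unfold W, x, y; rewrite mult_INR; change (INR 2) with 2.
    replace (T * exp (alpha * (l + v)) * (2 * exp (l + v) *
      (exp (INR p * l) * exp (- (2 * INR r * (l + v))))))
      with (T * 2 * (exp (alpha * (l + v)) * (exp (l + v) *
      (exp (INR p * l) * exp (- (2 * INR r * (l + v))))))) by ring.
    rewrite <- !exp_plus; apply Rmult_le_compat_l; [lra|]; apply exp_mono.
    assert (INR p / INR q <= INR p).
    { apply Rmult_le_reg_r with (INR q); [lra|]; field_simplify; [|lra]. nra. }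
    nra. }
apply Rle_trans with
  (sum_n_m (fun d => W * indic (near_power x r d) + W * (x / INR d ^ (2 * r))) (S a) b).
- apply Rsum_le; intros d Hd; rewrite <- Rmult_plus_distr_l.
  apply Rmult_le_compat_r; [|apply HT, Hd].
  pose proof (indic_bounds (near_power x r d)); apply HB in Hd.
  apply Rplus_le_le_0_compat; [lra|]; apply Rdiv_le_0_compat; [lra|apply pow_lt; lra].
- rewrite Rsum_plus, !Rsum_scal_l; lra.
Qed.

(** The blocks starting at [D 2^i] are dominated by a geometric series of ratio [2^(-delta)]. *)
Lemma dyadic_sum (w : nat -> R) (D B delta : R) :
  (forall n, (1 <= n)%nat -> 0 <= w n) -> 1 <= D -> 0 <= B -> 0 < delta ->
  (forall i : nat, sum_n_m w (S (floorN (D * 2 ^ i))) (floorN (2 * (D * 2 ^ i)))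
     <= B * exp (- delta * (INR i * ln 2))) ->
  forall M, sum_n_m w (S (floorN D)) M <= B / (1 - exp (- delta * ln 2)).
Proof.
intros Hw HD HB Hd H M.
set (rho := exp (- delta * ln 2)).
assert (L2 : 0 < ln 2) by (rewrite <- ln_1; apply ln_increasing; lra).
assert (R1 : 0 < rho < 1).
{ split; [apply exp_pos|]; rewrite <- exp_0; apply exp_increasing; nra. }
assert (P2 : forall i, 1 <= 2 ^ i) by (intros; apply pow_R1_Rle; lra).
assert (Mono : forall i, (floorN D <= floorN (D * 2 ^ i) <= floorN (2 * (D * 2 ^ i)))%nat).
{ intros i; pose proof (P2 i).
  assert (D <= D * 2 ^ i) by nra.
  split; apply floorN_ge; try lra.
  - pose proof (floorN_spec D); lra.
  - pose proof (floorN_spec (D * 2 ^ i)); lra. }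
assert (I : forall i, sum_n_m w (S (floorN D)) (floorN (D * 2 ^ i))
  <= B * (1 - rho ^ i) / (1 - rho)).
{ induction i as [|i IH].
  - simpl; rewrite Rmult_1_r, sum_n_m_zero by lia.
    unfold Rdiv; rewrite Rminus_diag, Rmult_0_r, Rmult_0_l; apply Rle_refl.
  - replace (D * 2 ^ S i) with (2 * (D * 2 ^ i)) by (simpl; ring).
    rewrite (Rsum_split _ _ (floorN (D * 2 ^ i))) by apply Mono.
    apply Rle_trans with (B * (1 - rho ^ i) / (1 - rho) + B * rho ^ i).
    + apply Rplus_le_compat; [trivial|].
      apply Rle_trans with (1 := H i); unfold rho; rewrite pow_exp; right; f_equal; f_equal; ring.
    + right; simpl; field; lra. }
(* [M] blocks suffice, since [M <= 2^M <= D 2^M]; the terms added beyond [M] are nonnegative. *)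
apply Rle_trans with (sum_n_m w (S (floorN D)) (floorN (D * 2 ^ M))).
- assert (HM : (M <= floorN (D * 2 ^ M))%nat).
  { pose proof (P2 M); apply floorN_ge; [nra|].
    apply Rle_trans with (INR 2 ^ M); [|change (INR 2) with 2; nra].
    rewrite <- pow_INR; apply le_INR, Nat.lt_le_incl, Nat.pow_gt_lin_r; lia. }
  destruct (le_lt_dec (floorN D) M) as [L|L].
  + rewrite (Rsum_split w (floorN D) M (floorN (D * 2 ^ M))) by lia.
    pose proof (Rsum_ge_0 w (S M) (floorN (D * 2 ^ M)) (fun n H => Hw n ltac:(lia))); lra.
  + rewrite sum_n_m_zero by lia; apply Rsum_ge_0; intros; apply Hw; lia.
- apply Rle_trans with (1 := I M); apply Rmult_le_compat_r.
  + left; apply Rinv_0_lt_compat; lra.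
  + rewrite <- (Rmult_1_r B) at 2; apply Rmult_le_compat_l; [trivial|].
    pose proof (pow_lt rho M); lra.
Qed.

(** * Reduction to a sum over near powers *)

(** For [d <= D = exp l] the bound [u d <= 1] gives [D * D^alpha]; for [d > D] the second bound on
    [u] is summed over dyadic blocks, the [i]-th having [v = i ln 2]. *)
Lemma weighted_sum_bound (r k : nat) (alpha : R) :
  (2 * k + 1 <= r)%nat -> 0 <= alpha ->
  (1 + alpha) * INR (2 * k + 1) < INR (r + k + 1) ->
  exists K : R, 0 <= K /\ forall (l : R) (u : nat -> R) (M : nat), 0 <= l ->
  let x := exp (INR (r + k + 1) * l) in
  (forall d, (1 <= d)%nat -> 0 <= u d <= 1) ->
  (forall d, (1 <= d)%nat -> u d <= indic (near_power x r d) + x / INR d ^ (2 * r)) ->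
  sum_n_m (fun d => Rpower (INR d) alpha * u d) 1 M <= K * exp ((1 + alpha) * l).
Proof.
intros Hr Ha Hq.
destruct (block_bound r k alpha Hr Ha Hq) as (K & delta & HK & Hd & HB).
assert (L2 : 0 < ln 2) by (rewrite <- ln_1; apply ln_increasing; lra).
assert (Hrho : 0 < 1 - exp (- delta * ln 2)).
{ assert (exp (- delta * ln 2) < 1); [|lra]. rewrite <- exp_0; apply exp_increasing; nra. }
set (K' := K / (1 - exp (- delta * ln 2))).
assert (HK' : 0 <= K') by (apply Rdiv_le_0_compat; trivial).
exists (1 + K'); split; [lra|].
intros l u M Hl x Hu1 Hu2.
set (D := exp l).
assert (HD : 1 <= D) by (rewrite <- exp_0; apply exp_mono, Hl).
assert (HDf := floorN_spec D ltac:(lra)).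
assert (X0 : 0 < x) by apply exp_pos.
set (w := fun d => Rpower (INR d) alpha * (indic (near_power x r d) + x / INR d ^ (2 * r))).
assert (Hw : forall d, (1 <= d)%nat -> 0 <= w d).
{ intros d Hd1; apply Rmult_le_pos; [left; apply exp_pos|].
  pose proof (indic_bounds (near_power x r d)).
  apply Rplus_le_le_0_compat; [lra|]; apply Rdiv_le_0_compat; [lra|].
  apply pow_lt, (lt_INR 0), Hd1. }
assert (Hu0 : forall d, (1 <= d)%nat -> 0 <= Rpower (INR d) alpha * u d).
{ intros d Hd1; apply Rmult_le_pos; [left; apply exp_pos|apply Hu1, Hd1]. }
assert (Small : forall N, (N <= floorN D)%nat ->
  sum_n_m (fun d => Rpower (INR d) alpha * u d) 1 N <= exp ((1 + alpha) * l)).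
{ intros N HN.
  eapply Rle_trans; [apply Rsum_le_const with (B := exp (alpha * l))|].
  - intros d Hd1; rewrite <- (Rmult_1_r (exp _)); apply Rmult_le_compat.
    + left; apply exp_pos.
    + apply Hu1; lia.
    + assert (d <= floorN D)%nat by lia. apply floorN_ge in H; [|lra].
      assert (1 <= INR d) by (apply (le_INR 1); lia).
      replace (exp (alpha * l)) with (Rpower D alpha)
        by (unfold Rpower, D; rewrite ln_exp; trivial).
      apply Rle_Rpower_l; lra.
    + apply Hu1; lia.
  - replace ((1 + alpha) * l) with (l + alpha * l) by ring; rewrite exp_plus.
    apply Rmult_le_compat_r; [left; apply exp_pos|].
    replace (S N - 1)%nat with N by lia; apply le_INR in HN; fold D; lra. }
rewrite Rmult_plus_distr_r, Rmult_1_l.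
assert (HKe : 0 <= K' * exp ((1 + alpha) * l)).
{ apply Rmult_le_pos; [trivial|left; apply exp_pos]. }
destruct (le_lt_dec M (floorN D)) as [L|L]; [pose proof (Small M L); lra|].
rewrite (Rsum_split _ 0 (floorN D)) by lia; apply Rplus_le_compat; [apply Small; lia|].
apply Rle_trans with (sum_n_m w (S (floorN D)) M).
- apply Rsum_le; intros d Hd1; apply Rmult_le_compat_l; [left; apply exp_pos|apply Hu2; lia].
- replace (K' * exp ((1 + alpha) * l))
    with (K * exp ((1 + alpha) * l) / (1 - exp (- delta * ln 2))) by (unfold K'; field; lra).
  apply dyadic_sum; trivial.
  + apply Rmult_le_pos; [trivial|left; apply exp_pos].
  + intros i.
    assert (Hi : 0 <= INR i * ln 2) by (apply Rmult_le_pos; [apply pos_INR|lra]).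
    specialize (HB l (INR i * ln 2) Hl Hi); cbv zeta in HB; fold x w in HB.
    replace (D * 2 ^ i) with (exp (l + INR i * ln 2)).
    * apply Rle_trans with (1 := HB); rewrite Rmult_assoc, <- exp_plus.
      right; f_equal; f_equal; ring.
    * rewrite exp_plus, <- pow_exp, exp_ln by lra; trivial.
Qed.

(** * Sums of [f_of] as sums over roots *)

Lemma f_of_pow (r d : nat) (h : nat -> C) : (1 <= r)%nat -> (1 <= d)%nat ->
  f_of r h (d ^ r) = h d.
Proof.
intros Hr Hd; unfold f_of.
destruct excluded_middle_informative as [H|H]; [|destruct H; eauto].
destruct constructive_indefinite_description as (d' & H1 & H2); simpl.
apply Nat.pow_inj_l in H2; [congruence|lia].
Qed.

Lemma f_of_not_pow (r m : nat) (h : nat -> C) :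
  (forall d, (1 <= d)%nat -> (d ^ r)%nat <> m) -> f_of r h m = RtoC 0.
Proof.
intros H; unfold f_of.
destruct excluded_middle_informative as [(d & Hd & E)|_]; trivial.
destruct (H d Hd E).
Qed.

(** Induction on [D]: strictly between [D^r] and [(D + 1)^r] there is no [r]-th power, so only the
    last term is new. *)
Lemma f_of_sum_pow (r : nat) (h : nat -> C) (u : nat -> R) (D : nat) : (1 <= r)%nat ->
  sum_n_m (fun m => Cmod (f_of r h m) * u m) 1 (D ^ r)
  = sum_n_m (fun d => Cmod (h d) * u (d ^ r)%nat) 1 D.
Proof.
intros Hr; induction D as [|D IH].
- rewrite Nat.pow_0_l by lia; rewrite !sum_n_m_zero by lia; trivial.
- assert (Hlt : (D ^ r < S D ^ r)%nat) by (apply Nat.pow_lt_mono_l; lia).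
  destruct (S D ^ r)%nat as [|p] eqn:E; [lia|].
  rewrite (Rsum_split _ 0 p) by lia; rewrite sum_n_n.
  rewrite (Rsum_split _ 0 (D ^ r) p) by lia; rewrite IH.
  rewrite (Rsum_split _ 0 D (S D)) by lia; rewrite sum_n_n, E.
  rewrite <- (f_of_pow r (S D) h), E by lia.
  rewrite (sum_n_m_ext_loc _ (fun _ => 0) (S (D ^ r)) p).
  + rewrite sum_n_m_const, Rmult_0_r, Rplus_0_r; trivial.
  + intros m Hm; rewrite f_of_not_pow; [rewrite Cmod_0; apply Rmult_0_l|].
    intros d Hd Ed. destruct (le_lt_dec d D) as [L|L].
    * pose proof (Nat.pow_le_mono_l d D r L); lia.
    * pose proof (Nat.pow_le_mono_l (S D) d r L); lia.
Qed.

Lemma f_of_sum_le (r : nat) (h : nat -> C) (u : nat -> R) (M : nat) : (1 <= r)%nat ->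
  (forall m, (1 <= m)%nat -> 0 <= u m) ->
  sum_n_m (fun m => Cmod (f_of r h m) * u m) 1 M
  <= sum_n_m (fun d => Cmod (h d) * u (d ^ r)%nat) 1 M.
Proof.
intros Hr Hu; rewrite <- f_of_sum_pow by trivial.
assert (HM : (M <= M ^ r)%nat).
{ destruct M as [|M]; [lia|]; rewrite <- (Nat.pow_1_r (S M)) at 1; apply Nat.pow_le_mono_r; lia. }
rewrite (Rsum_split _ 0 M (M ^ r)) by lia.
assert (0 <= sum_n_m (fun m => Cmod (f_of r h m) * u m) (S M) (M ^ r)); [|lra].
apply Rsum_ge_0; intros m Hm; apply Rmult_le_pos; [apply Cmod_ge_0|apply Hu; lia].
Qed.

(** * Multiplicity of a quotient *)

Lemma floorN_div (x : R) (n : nat) : 0 <= x -> (1 <= n)%nat ->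
  floorN (x / INR n) = (floorN x / n)%nat.
Proof.
intros Hx Hn.
assert (Hn0 : 0 < INR n) by (apply (lt_INR 0), Hn).
assert (Hxn : 0 <= x / INR n) by (apply Rdiv_le_0_compat; trivial).
assert (H : forall a, (a <= floorN (x / INR n))%nat <-> (a <= floorN x / n)%nat).
{ intros a; rewrite floorN_ge by trivial.
  transitivity (n * a <= floorN x)%nat.
  - rewrite floorN_ge by trivial; rewrite mult_INR; split; intros H.
    + apply Rmult_le_compat_l with (r := INR n) in H; [|lra].
      replace (INR n * (x / INR n)) with x in H by (field; lra); trivial.
    + apply Rmult_le_reg_l with (INR n); trivial.
      replace (INR n * (x / INR n)) with x by (field; lra); trivial.
  - split; intros H.
    + apply Nat.div_le_lower_bound; lia.
    + pose proof (Nat.Div0.mul_div_le (floorN x) n); nia. }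
pose proof (proj1 (H _) (le_n _)); pose proof (proj2 (H _) (le_n _)); lia.
Qed.

(** For [m >= 1], the number of [n] with [X / n = m], which are those with
    [X / (m + 1) < n <= X / m]. *)
Definition quot_count (X m : nat) : nat := (X / m - X / S m)%nat.

Lemma Csum_const (z : C) (a b : nat) : (a <= b)%nat ->
  sum_n_m (fun _ => z) (S a) b = Cmult (RtoC (INR (b - a))) z.
Proof.
induction b as [|b IH]; intros H.
- rewrite sum_n_m_zero by lia; replace (0 - a)%nat with 0%nat by lia.
  symmetry; apply Cmult_0_l.
- destruct (Nat.eq_dec a (S b)) as [->|N].
  + rewrite sum_n_m_zero by lia; rewrite Nat.sub_diag; symmetry; apply Cmult_0_l.
  + rewrite sum_n_Sm, IH by lia.
    replace (S b - a)%nat with (S (b - a)) by lia;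
    rewrite S_INR, RtoC_plus, Cmult_plus_distr_r, Cmult_1_l.
    reflexivity.
Qed.

(** The [n] with quotient at most [M] are those above [X / (M + 1)]; each step of the induction on
    [M] adds the interval on which the quotient is [M + 1]. *)
Lemma sum_quot (g : nat -> C) (X M : nat) :
  sum_n_m (fun m => Cmult (RtoC (INR (quot_count X m))) (g m)) 1 M
  = sum_n_m (fun n => g (X / n)%nat) (S (X / S M)) X.
Proof.
induction M as [|M IH].
- rewrite Nat.div_1_r, !sum_n_m_zero by lia; trivial.
- rewrite sum_n_Sm, IH by lia.
  assert (Hle : (X / S (S M) <= X / S M)%nat) by (apply Nat.div_le_compat_l; lia).
  assert (HX : (X / S M <= X)%nat).
  { rewrite <- (Nat.div_1_r X) at 2; apply Nat.div_le_compat_l; lia. }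
  rewrite (sum_n_m_Chasles _ (S (X / S (S M))) (X / S M) X) by lia.
  rewrite plus_comm; f_equal.
  rewrite (sum_n_m_ext_loc _ (fun _ => g (S M))).
  + rewrite Csum_const by trivial; trivial.
  + intros n Hn; f_equal.
    apply Nat.le_antisymm.
    * apply Nat.lt_succ_r, Nat.Div0.div_lt_upper_bound.
      assert (H := Nat.mul_succ_div_gt X (S (S M)) ltac:(lia)); nia.
    * apply Nat.div_le_lower_bound; [lia|].
      pose proof (Nat.Div0.mul_div_le X (S M)); nia.
Qed.

(** As [x / (m (m + 1)) = x / m - x / (m + 1)], the error is a difference of two fractional
    parts. *)
Lemma quot_count_error (x : R) (m : nat) : 0 <= x -> (1 <= m)%nat ->
  Rabs (INR (quot_count (floorN x) m) - x / (INR m * INR (S m))) <= 1.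
Proof.
intros Hx Hm; unfold quot_count.
rewrite minus_INR by (apply Nat.div_le_compat_l; lia).
rewrite <- !floorN_div by (trivial; lia).
assert (Hm0 : 0 < INR m) by (apply (lt_INR 0), Hm).
assert (HS : INR (S m) = INR m + 1) by apply S_INR.
pose proof (floorN_spec (x / INR m) ltac:(apply Rdiv_le_0_compat; lra)).
pose proof (floorN_spec (x / INR (S m)) ltac:(apply Rdiv_le_0_compat; lra)).
replace (x / (INR m * INR (S m))) with (x / INR m - x / INR (S m)).
- apply Rabs_le; lra.
- rewrite HS; field; lra.
Qed.

(** The witness is the largest [n] with [n d^r <= x]; a nonzero count puts it above
    [x / (d^r + 1)]. *)
Lemma quot_count_near (x : R) (r d : nat) : 0 <= x -> (1 <= d)%nat ->
  quot_count (floorN x) (d ^ r) <> 0%nat -> near_power x r d.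
Proof.
unfold quot_count; intros Hx Hd H.
exists (floorN x / d ^ r)%nat; set (n := (floorN x / d ^ r)%nat) in *.
assert (Hdr : (d ^ r <> 0)%nat) by (apply Nat.pow_nonzero; lia).
rewrite <- pow_INR, <- S_INR, <- !mult_INR; split.
- apply floorN_ge; trivial; rewrite Nat.mul_comm; apply Nat.Div0.mul_div_le.
- apply floorN_lt; trivial.
  pose proof (Nat.mul_succ_div_gt (floorN x) (S (d ^ r)) ltac:(lia)); nia.
Qed.

(** If the count is 0, the error is the main term itself; otherwise [d] is near and the error is at
    most 1. *)
Lemma quot_count_error_near (x : R) (r d : nat) : 0 <= x -> (1 <= d)%nat ->
  Rabs (INR (quot_count (floorN x) (d ^ r)) - x / (INR (d ^ r) * INR (S (d ^ r))))
  <= indic (near_power x r d) + x / INR d ^ (2 * r).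
Proof.
intros Hx Hd.
assert (Hdr : (1 <= d ^ r)%nat) by (pose proof (Nat.pow_nonzero d r); lia).
assert (Hm0 : 1 <= INR (d ^ r)) by (apply (le_INR 1), Hdr).
assert (HS : INR (S (d ^ r)) = INR (d ^ r) + 1) by apply S_INR.
assert (Hq : x / (INR (d ^ r) * INR (S (d ^ r))) <= x / INR d ^ (2 * r)).
{ apply Rmult_le_compat_l; trivial.
  replace (2 * r)%nat with (r + r)%nat by lia; rewrite pow_add, <- !pow_INR.
  apply Rinv_le_contravar; nra. }
assert (0 <= x / (INR (d ^ r) * INR (S (d ^ r)))) by (apply Rdiv_le_0_compat; nra).
destruct (Nat.eq_dec (quot_count (floorN x) (d ^ r)) 0) as [E|E].
- rewrite E; simpl (INR 0); rewrite Rminus_0_l, Rabs_Ropp, Rabs_pos_eq by trivial.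
  pose proof (indic_bounds (near_power x r d)); lra.
- rewrite indic_true by (apply quot_count_near; trivial).
  pose proof (quot_count_error x (d ^ r) Hx Hdr); lra.
Qed.

(** * The asymptotic formula *)

(** The weight [u] is left abstract to serve twice: for the absolute convergence of [C_f] and for
    the error term. *)
Lemma f_of_weighted_bound (r k : nat) (alpha A : R) (h : nat -> C) :
  (2 * k + 1 <= r)%nat -> 0 <= alpha ->
  (1 + alpha) * INR (2 * k + 1) < INR (r + k + 1) ->
  (forall d : nat, (1 <= d)%nat -> Cmod (h d) <= A * Rpower (INR d) alpha) ->
  exists K : R, forall (l : R) (u : nat -> R) (M : nat), 0 <= l ->
  let x := exp (INR (r + k + 1) * l) in
  (forall m, (1 <= m)%nat -> 0 <= u m <= 1) ->
  (forall d, (1 <= d)%nat -> u (d ^ r)%nat <= indic (near_power x r d) + x / INR d ^ (2 * r)) ->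
  sum_n_m (fun m => Cmod (f_of r h m) * u m) 1 M <= K * exp ((1 + alpha) * l).
Proof.
intros Hr Ha Hq Hh.
destruct (weighted_sum_bound r k alpha Hr Ha Hq) as (K & HK & HB).
exists (A * K); intros l u M Hl x Hu1 Hu2.
(* Take [d = 1], where [Rpower 1 alpha = 1]. *)
assert (HA : 0 <= A).
{ specialize (Hh 1%nat (le_n _)); pose proof (Cmod_ge_0 (h 1%nat)).
  change (INR 1) with 1 in Hh; unfold Rpower in Hh; rewrite ln_1, Rmult_0_r, exp_0 in Hh; lra. }
assert (Hpow : forall d, (1 <= d)%nat -> (1 <= d ^ r)%nat).
{ intros d Hd; pose proof (Nat.pow_nonzero d r); lia. }
eapply Rle_trans; [apply f_of_sum_le; [lia|intros; apply Hu1; trivial]|].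
apply Rle_trans with (sum_n_m (fun d => A * (Rpower (INR d) alpha * u (d ^ r)%nat)) 1 M).
- apply Rsum_le; intros d Hd; rewrite <- Rmult_assoc.
  apply Rmult_le_compat_r; [apply Hu1, Hpow|apply Hh]; lia.
- rewrite Rsum_scal_l, Rmult_assoc; apply Rmult_le_compat_l; [trivial|].
  apply (HB l (fun d => u (d ^ r)%nat)); trivial.
  intros d Hd; apply Hu1, Hpow, Hd.
Qed.

Lemma ex_series_bounded (b : nat -> R) (B : R) :
  (forall n, 0 <= b n) -> (forall n, sum_n b n <= B) -> ex_series b.
Proof.
intros H1 H2.
destruct (ex_finite_lim_seq_incr (sum_n b) B) as [l Hl]; trivial.
- intros n; rewrite sum_Sn; unfold plus; simpl; pose proof (H1 (S n)); lra.
- exists l; exact Hl.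
Qed.

Lemma sum_f_of_quot (r k : nat) (alpha A : R) (h : nat -> C) :
  (2 * k + 1 <= r)%nat -> 0 <= alpha ->
  (1 + alpha) * INR (2 * k + 1) < INR (r + k + 1) ->
  (forall d : nat, (1 <= d)%nat -> Cmod (h d) <= A * Rpower (INR d) alpha) ->
  exists Cf : C,
    is_series (fun n : nat =>
        Cdiv (f_of r h (S n)) (RtoC (INR (S n) * INR (S (S n))))) Cf /\
    exists K : R, forall x : R, 1 <= x ->
      Cmod (Cminus (S_sum (f_of r h) x) (Cmult Cf (RtoC x)))
        <= K * Rpower x ((1 + alpha) / INR (r + k + 1)).
Proof.
intros Hr Ha Hq Hh.
destruct (f_of_weighted_bound r k alpha A h Hr Ha Hq Hh) as (K & HK).
set (f := f_of r h) in *; set (p := (r + k + 1)%nat) in *.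
set (a' := fun m => Cdiv (f m) (RtoC (INR m * INR (S m)))).
assert (Hpos : forall m, (1 <= m)%nat -> 1 <= INR m * INR (S m)).
{ intros m Hm; rewrite <- mult_INR; apply (le_INR 1); lia. }
assert (Hmod : forall m, (1 <= m)%nat -> Cmod (a' m) = Cmod (f m) * / (INR m * INR (S m))).
{ intros m Hm; specialize (Hpos m Hm); unfold a'.
  rewrite Cmod_div by (intros E; apply RtoC_inj in E; lra).
  rewrite Cmod_R, Rabs_pos_eq by lra; trivial. }
assert (Hshift : forall N, sum_n (fun n => a' (S n)) N = sum_n_m a' 1 (S N)).
{ intros N; unfold sum_n; apply (sum_n_m_S (G := C_AbelianMonoid) a'). }
assert (Hex : ex_series (V := C_NormedModule) (fun n => a' (S n))).
{ apply (ex_series_le (V := C_CompleteNormedModule) (fun n => a' (S n)) (fun n => Cmod (a' (S n)))).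
  { intros n; apply Rle_refl. }
  (* The weighted bound at [l = 0], that is [x = 1], with weight [1 / (m (m + 1))] bounds all
     partial sums. *)
  apply ex_series_bounded with (K * exp ((1 + alpha) * 0)); [intros; apply Cmod_ge_0|].
  intros N; unfold sum_n; rewrite (sum_n_m_S (G := R_AbelianMonoid) (fun n => Cmod (a' n))).
  rewrite (sum_n_m_ext_loc _ (fun m => Cmod (f m) * / (INR m * INR (S m))))
    by (intros; apply Hmod; lia).
  apply HK; [lra| |].
  - intros m Hm; specialize (Hpos m Hm); split.
    + left; apply Rinv_0_lt_compat; lra.
    + rewrite <- Rinv_1; apply Rinv_le_contravar; lra.
  - intros d Hd; rewrite Rmult_0_r, exp_0.
    assert (1 <= INR (d ^ r)) by (apply (le_INR 1); pose proof (Nat.pow_nonzero d r); lia).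
    apply Rle_trans with (0 + 1 / INR d ^ (2 * r)); [|apply Rplus_le_compat_r, indic_bounds].
    unfold Rdiv; rewrite Rplus_0_l, Rmult_1_l.
    replace (2 * r)%nat with (r + r)%nat by lia; rewrite pow_add, <- !pow_INR, S_INR.
    apply Rinv_le_contravar; nra. }
destruct Hex as [Cf HCf]; exists Cf; split; [exact HCf|].
exists K; intros x Hx.
assert (P0 : 1 <= INR p) by (apply (le_INR 1); unfold p; lia).
set (l := ln x / INR p).
assert (Hl : 0 <= l).
{ apply Rdiv_le_0_compat; [|lra]. rewrite <- ln_1; apply ln_le; lra. }
assert (Hxl : exp (INR p * l) = x).
{ unfold l; replace (INR p * (ln x / INR p)) with (ln x) by (field; lra); apply exp_ln; lra. }
replace (Rpower x ((1 + alpha) / INR p)) with (exp ((1 + alpha) * l))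
  by (unfold Rpower, l; f_equal; field; lra).
set (X := floorN x).
(* For [M >= X] every quotient is at most [M], so truncating the series at [M] leaves exactly the
   sum of the errors [e m], bounded uniformly in [M]. *)
assert (Hpart : forall M, (X <= M)%nat ->
  Cmod (Cminus (S_sum f x) (Cmult (sum_n_m a' 1 M) (RtoC x))) <= K * exp ((1 + alpha) * l)).
{ intros M HM.
  set (e := fun m => INR (quot_count X m) - x / (INR m * INR (S m))).
  assert (E : Cminus (S_sum f x) (Cmult (sum_n_m a' 1 M) (RtoC x))
              = sum_n_m (fun m => Cmult (RtoC (e m)) (f m)) 1 M).
  { rewrite (sum_n_m_ext_loc (fun m => Cmult (RtoC (e m)) (f m))
      (fun m => plus (Cmult (RtoC (INR (quot_count X m))) (f m)) (mult (RtoC (- x)) (a' m)))).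
    - rewrite (sum_n_m_plus (G := C_AbelianMonoid)), (sum_n_m_mult_l (K := C_Ring)), sum_quot.
      rewrite Nat.div_small by lia.
      unfold S_sum; fold X.
      rewrite (sum_n_m_ext_loc (fun n => f (floorN (x / INR n))) (fun n => f (X / n)%nat)).
      + change (@plus C_AbelianMonoid) with Cplus; change (@mult C_Ring) with Cmult.
        rewrite RtoC_opp; unfold Cminus; f_equal.
        assert (R : forall z t : C, Copp (Cmult z t) = Cmult (Copp t) z) by (intros; ring).
        apply R.
      + intros n Hn; f_equal; apply floorN_div; [lra|lia].
    - intros m Hm; specialize (Hpos m ltac:(lia)).
      change (@plus C_AbelianMonoid) with Cplus; change (@mult C_Ring) with Cmult.
      unfold e, a', Rdiv.
      rewrite RtoC_minus, RtoC_opp, RtoC_mult, RtoC_inv by (apply Rgt_not_eq; lra).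
      unfold Cdiv; match goal with |- ?u = ?v => change (@eq C u v) end; ring. }
  rewrite E.
  eapply Rle_trans; [apply (norm_sum_n_m (V := C_NormedModule))|].
  change (sum_n_m (fun m => Cmod (Cmult (RtoC (e m)) (f m))) 1 M <= K * exp ((1 + alpha) * l)).
  rewrite (sum_n_m_ext_loc _ (fun m => Cmod (f m) * Rabs (e m)))
    by (intros; rewrite Cmod_mult, Cmod_R; apply Rmult_comm).
  apply HK; trivial.
  - intros m Hm; split; [apply Rabs_pos|apply quot_count_error; trivial; lra].
  - intros d Hd; rewrite Hxl; apply quot_count_error_near; trivial; lra. }
(* Let [M] tend to infinity; the tolerance [eps / x] compensates the factor [x] beside [Cf]. *)
apply le_epsilon; intros eps Heps.
assert (He : 0 < eps / x) by (apply Rdiv_lt_0_compat; lra).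
destruct (HCf (fun z => Cmod (Cminus z Cf) < eps / x)) as [N HN].
{ apply (locally_le_locally_norm (V := C_NormedModule)).
  exists (mkposreal _ He); intros z Hz; exact Hz. }
specialize (HN (max N X) ltac:(lia)).
specialize (Hpart (S (max N X)) ltac:(lia)).
rewrite <- Hshift in Hpart.
set (s := sum_n (fun n => a' (S n)) (max N X)) in *.
replace (Cminus (S_sum f x) (Cmult Cf (RtoC x)))
  with (Cplus (Cminus (S_sum f x) (Cmult s (RtoC x))) (Cmult (Cminus s Cf) (RtoC x))) by ring.
eapply Rle_trans; [apply Cmod_triangle|].
rewrite Cmod_mult, Cmod_R, (Rabs_pos_eq x) by lra.
apply Rplus_le_compat; [trivial|].
replace eps with (eps / x * x) by (field; lra).
apply Rmult_le_compat_r; [lra|left; exact HN].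
Qed.

Theorem theorem1 (r : nat) (alpha : R) (h : nat -> C) :
  (1 <= r)%nat ->
  0 <= alpha ->
  alpha < (INR r + 2 - eta r) / (2 * INR r - 2 + 2 * eta r) ->
  (exists A : R, forall d : nat, (1 <= d)%nat -> Cmod (h d) <= A * Rpower (INR d) alpha) ->
  exists Cf : C,
    is_series (fun n : nat =>
        Cdiv (f_of r h (S n)) (RtoC (INR (S n) * INR (S (S n))))) Cf /\
    exists K : R, forall x : R, 2 <= x ->
      Cmod (Cminus (S_sum (f_of r h) x) (Cmult Cf (RtoC x)))
        <= K * Rpower x (2 * (1 + alpha) / (3 * INR r + eta r)).
Proof.
intros Hr Ha Halpha [A HA].
(* The largest [k] with [2 k + 1 <= r]: [r] is [2 k + 1] when odd and [2 k + 2] when even. *)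
set (k := ((r - 1) / 2)%nat).
assert (Hk : (2 * k + 1 <= r)%nat).
{ pose proof (Nat.Div0.mul_div_le (r - 1) 2); unfold k; lia. }
assert (Heta : INR r = 2 * INR k + 2 - eta r).
{ assert (Hpar : r = (2 * k + 2 - if Nat.odd r then 1 else 0)%nat).
  { pose proof (Nat.div_mod_eq (r - 1) 2) as Hdm; fold k in Hdm.
    pose proof (Nat.mod_upper_bound (r - 1) 2 ltac:(lia)).
    destruct (Nat.odd r) eqn:E.
    - apply Nat.odd_spec in E; destruct E as [j Hj]; lia.
    - rewrite <- Nat.negb_even in E; apply Bool.negb_false_iff, Nat.even_spec in E.
      destruct E as [j Hj]; lia. }
  unfold eta; rewrite Hpar at 1; rewrite minus_INR, plus_INR, mult_INR
    by (destruct (Nat.odd r); lia).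
  destruct (Nat.odd r); simpl; lra. }
assert (Hp : INR (r + k + 1) = (3 * INR r + eta r) / 2).
{ rewrite !plus_INR; simpl (INR 1); lra. }
assert (Hq : INR (2 * k + 1) = 2 * INR k + 1) by (rewrite plus_INR, mult_INR; trivial).
pose proof (pos_INR k).
assert (eta r <= 1) by (unfold eta; destruct (Nat.odd r); lra).
destruct (sum_f_of_quot r k alpha A h Hk Ha) as (Cf & HCf & K & HK); trivial.
(* Here [2 r - 2 + 2 eta = 2 (2 k + 1)] is positive; clearing it and adding [2 k + 1 = r - 1 + eta]
   turns the bound on [alpha] into [(1 + alpha) (2 k + 1) < (3 r + eta) / 2]. *)
{ rewrite Hp, Hq.
  apply Rmult_lt_compat_r with (r := 2 * INR r - 2 + 2 * eta r) in Halpha; [|lra].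
  replace ((INR r + 2 - eta r) / (2 * INR r - 2 + 2 * eta r) * (2 * INR r - 2 + 2 * eta r))
    with (INR r + 2 - eta r) in Halpha by (field; lra).
  replace (2 * INR r - 2 + 2 * eta r) with (2 * (2 * INR k + 1)) in Halpha by lra.
  lra. }
exists Cf; split; [trivial|]; exists K; intros x Hx.
replace (2 * (1 + alpha) / (3 * INR r + eta r)) with ((1 + alpha) / INR (r + k + 1))
  by (rewrite Hp; field; apply Rgt_not_eq; lra).
apply HK; lra.
Qed.
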